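(* Let $q$ be a power of an odd prime. Every vector in $\mathbb{F}_q^3$ is the sum of $3$ unit vectors if $q \equiv 3 \pmod 4$, and every vector in $\mathbb{F}_q^3$ is the sum of $2$ unit vectors if $q \equiv 1 \pmod 4$.
   Context: For $x \in \mathbb{F}_q^d$, $\|x\| = x_1^2+\dots+x_d^2 \in \mathbb{F}_q$, and $x$ is a unit vector if and only if $\|x\| = 1$. ''$x$ is the sum of $m$ unit vectors'' means $x = u_1+\dots+u_m$ with each $u_j$ a unit vector in the same space, repetitions allowed. *)

(* Defs.v *)
From HB Require Import structures.
From mathcomp Require Import all_boot all_order all_algebra.

Set Implicit Arguments.
Unset Strict Implicit.
Unset Printing Implicit Defensive.

Import GRing.Theory.
Local Open Scope ring_scope.

(* The "norm" is F-valued, with no square root taken. *)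
Definition sqnorm (F : finFieldType) (d : nat) (x : 'rV[F]_d) : F :=
  \sum_(i < d) x 0 i ^+ 2.

Definition unit_vector (F : finFieldType) (d : nat) (x : 'rV[F]_d) : Prop :=
  sqnorm x = 1.

Definition sum_of_unit_vectors (F : finFieldType) (d m : nat)
    (x : 'rV[F]_d) : Prop :=
  exists u : 'I_m -> 'rV[F]_d,
    (forall j, unit_vector (u j)) /\ x = \sum_(j < m) u j.

(* Main.v *)
Require Import Defs.
From HB Require Import structures.
From mathcomp Require Import all_boot all_order all_algebra.
From mathcomp Require Import fingroup cyclic finfield ring.

Set Implicit Arguments.
Unset Strict Implicit.
Unset Printing Implicit Defensive.

Import GRing.Theory.
Local Open Scope ring_scope.

(** For [x] in [F^3], splitting [x] into two unit vectors amounts to writing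
    [x = (x / 2 + w) + (x / 2 - w)] with [w] orthogonal to [x] and
    [||w|| = 1 - ||x|| / 4].

    If [||x|| <> 0], the plane orthogonal to [x] is nondegenerate, and a
    nondegenerate binary quadratic form over a finite field of odd order takes
    every value, by pigeonhole ([binary_form_universal]); so [x] is a sum of
    two unit vectors ([two_units_anisotropic]), whatever [q] is modulo 4.

    If [||x|| = 0] and [x <> 0], the form induced on the orthogonal of [x] is
    degenerate: in a suitable basis it is minus the square of a coordinate.
    When [q = 1 %[mod 4]] it takes the value [1] because [-1] is a square
    ([sqrt_m1], [two_units_isotropic]).  When [q = 3 %[mod 4]] a third
    vector helps: subtracting one of the six vectors [+-e_i] from any [x] yields
    a vector of nonzero norm ([unit_translate_anisotropic]), to which the first
    case applies. *)

(** * Finite fields of odd order *)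

Section OddFiniteField.

Variable F : finFieldType.
Hypothesis oddF : odd #|F|.

(** The additive order of [1] divides the odd number [#|F|]. *)
Lemma two_neq0 : (2 : F) != 0.
Proof.
apply/eqP => two0.
have : (1 : F) *+ #|F| = 0.
  by rewrite -cardsT -FinRing.zmodXgE expg_cardG ?inE.
rewrite -(odd_double_half #|F|) oddF -muln2 mulrnDr mulnC mulrnA two0 mul0rn.
by rewrite addr0 => /eqP; rewrite oner_eq0.
Qed.

Definition squares : {set F} := [set x ^+ 2 | x : F].

(** Squaring is at most two-to-one; the inequality is strict because [#|F|]
    is odd. *)
Lemma card_squares : (#|F| < #|squares| + #|squares|)%N.
Proof.
have le : (#|F| <= #|squares| * 2)%N.
  rewrite -sum_nat_const -sum1_card.
  rewrite (partition_big_imset (fun x : F => x ^+ 2)) leq_sum // => y.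
  case/imsetP => x _ ->.
  rewrite sum1_card.
  apply: leq_trans (subset_leq_card _) (_ : #|[set x; - x]| <= 2)%N.
    by apply/subsetP => z; rewrite !inE -eqf_sqr.
  by rewrite cards2; case: eqP.
rewrite addnn -muln2 ltn_neqAle le andbT.
by apply: contraTneq oddF => ->; rewrite oddM andbF.
Qed.

(** The values of [A t^2] and those of [c - B t^2] each fill more than half of
    the field, so the two sets meet. *)
Lemma binary_form_universal (A B c : F) : A != 0 -> B != 0 ->
  exists s t, A * s ^+ 2 + B * t ^+ 2 = c.
Proof.
move=> A0 B0.
pose SA := [set A * y | y in squares].
pose SB := [set c - B * y | y in squares].
have cA : #|SA| = #|squares| by rewrite card_imset //; apply: mulfI.
have cB : #|SB| = #|squares|.
  by rewrite card_imset // => y z /addrI/oppr_inj/(mulfI B0).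
have : SA :&: SB != set0.
  rewrite -card_gt0 -subn_gt0 subn0 -(ltn_add2l #|SA :|: SB|) addn0.
  rewrite cardsUI cA cB; apply: leq_ltn_trans card_squares; exact: max_card.
case/set0Pn => z /setIP[/imsetP[_ /imsetP[s _ ->] ->]].
by case/imsetP => _ /imsetP[t _ ->] e; exists s, t; rewrite e subrK.
Qed.

(** The polynomial [X^((q-1)/2) - 1] cannot vanish at all [q - 1] nonzero
    elements, so some [g] has [g^((q-1)/2) = -1], and [g^((q-1)/4)] works. *)
Lemma sqrt_m1 : (#|F| = 1 %[mod 4])%N -> exists i : F, i ^+ 2 = -1.
Proof.
move=> q1.
pose k := (#|F| %/ 4)%N.
have qk : #|F| = (k * 4).+1 by rewrite {1}(divn_eq #|F| 4) q1 addn1.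
have k0 : (0 < k)%N.
  by have := finNzRing_gt1 F; rewrite qk; case: (k).
have [g g0 gk] : exists2 g : F, g != 0 & g ^+ (k * 2) != 1.
  apply/exists_inP; apply: contraT.
  rewrite negb_exists_in => /forall_inP all1.
  have size_p : size ('X^(k * 2) - 1%:P : {poly F}) = (k * 2).+1.
    by rewrite size_XnsubC // muln_gt0 k0.
  have p0 : 'X^(k * 2) - 1%:P != 0 :> {poly F}.
    by rewrite -size_poly_eq0 size_p.
  have := @max_poly_roots _ _ (enum [set~ (0 : F)]) p0.
  rewrite enum_uniq size_p -cardE cardsC1 qk /=.
  rewrite ltnS leq_pmul2l // => too_many_roots.
  suff /too_many_roots/(_ isT) :
    all (root ('X^(k * 2) - 1%:P)) (enum [set~ (0 : F)]) by [].
  apply/allP => x; rewrite mem_enum !inE => x0.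
  by rewrite /root !hornerE subr_eq0; apply/negPn/all1.
exists (g ^+ k).
have : (g ^+ (k * 2)) ^+ 2 == 1.
  have := expf_card g; rewrite qk exprS -[RHS]mulr1 => /(mulfI g0).
  by rewrite -exprM -mulnA => ->.
by rewrite sqrf_eq1 (negPf gk) /= => /eqP; rewrite exprM.
Qed.

(** * Two unit vectors in coordinates *)

Definition two_units (a b c : F) := exists u v w,
  u ^+ 2 + v ^+ 2 + w ^+ 2 = 1 /\
  (a - u) ^+ 2 + (b - v) ^+ 2 + (c - w) ^+ 2 = 1.

Lemma two_units_rot a b c : two_units a b c -> two_units b c a.
Proof.
move=> [u [v [w [h1 h2]]]]; exists v, w, u.
by split; [rewrite -[RHS]h1 | rewrite -[RHS]h2]; ring.
Qed.

(** The vectors [e = (b, -a, 0)] and [f = (ac, bc, -(a^2 + b^2))] form an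
    orthogonal basis of the plane orthogonal to [x = (a, b, c)], with norms
    [a^2 + b^2] and [(a^2 + b^2) ||x||]. *)
Lemma two_units_anisotropic_xy a b c :
  a ^+ 2 + b ^+ 2 != 0 -> a ^+ 2 + b ^+ 2 + c ^+ 2 != 0 -> two_units a b c.
Proof.
set m := a ^+ 2 + b ^+ 2; set N := m + c ^+ 2 => m0 N0.
have [s [t st]] :=
  binary_form_universal (1 - N / 4) m0 (mulf_neq0 m0 N0).
have two0 := two_neq0.
have four0 : (4 : F) != 0 by rewrite -[4%N]/(2 * 2)%N natrM mulf_neq0.
exists (a / 2 + s * b + t * (a * c)), (b / 2 - s * a + t * (b * c)),
  (c / 2 - t * m).
by split; rewrite -[RHS](subrK (N / 4)) -st /N /m; field; rewrite ?two0 ?four0.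
Qed.

Lemma two_units_anisotropic a b c :
  a ^+ 2 + b ^+ 2 + c ^+ 2 != 0 -> two_units a b c.
Proof.
move=> N0.
have [ab0|] := eqVneq (a ^+ 2 + b ^+ 2) 0; last first.
  by move/two_units_anisotropic_xy; apply.
have [bc0|bc0] := eqVneq (b ^+ 2 + c ^+ 2) 0; last first.
  by do 2!apply: two_units_rot; apply: two_units_anisotropic_xy => //;
    rewrite addrC addrA.
apply/two_units_rot/two_units_anisotropic_xy; last first.
  by apply: contra_neq N0 => <-; ring.
(* The three partial norms add up to [2 ||x||], so they do not all vanish. *)
apply: contra_neq (mulf_neq0 two_neq0 N0) => ca0.
transitivity ((a ^+ 2 + b ^+ 2) + (b ^+ 2 + c ^+ 2) + (c ^+ 2 + a ^+ 2)).
  by ring.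
by rewrite ab0 bc0 ca0 !addr0.
Qed.

(** The vector [(b, -a, 0) / c] is orthogonal to [x = (a, b, c)] and, since
    [a^2 + b^2 = - c^2], has norm [-1]; multiplying it by a square root of [-1]
    gives a unit vector [u].  Then [||x - u|| = ||x|| + ||u|| = 1]. *)
Lemma two_units_isotropic_z (i a b c : F) : i ^+ 2 = -1 -> c != 0 ->
  a ^+ 2 + b ^+ 2 + c ^+ 2 = 0 -> two_units a b c.
Proof.
move=> i2 c0 N0; exists (i * b / c), (- (i * a / c)), 0.
have n1 : (i * b / c) ^+ 2 + (- (i * a / c)) ^+ 2 + 0 ^+ 2 = 1.
  transitivity (i ^+ 2 * ((a ^+ 2 + b ^+ 2 + c ^+ 2) - c ^+ 2) / c ^+ 2).
    by field.
  by rewrite i2 N0; field.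
split=> //; rewrite -[RHS]n1 -[RHS]add0r -[X in _ = X + _]N0; ring.
Qed.

Lemma two_units_isotropic (i a b c : F) : i ^+ 2 = -1 ->
  a ^+ 2 + b ^+ 2 + c ^+ 2 = 0 -> two_units a b c.
Proof.
move=> i2 N0.
have [c0|c0] := eqVneq c 0; last exact: two_units_isotropic_z i2 c0 N0.
have [b0|b0] := eqVneq b 0; last first.
  apply/two_units_rot/(two_units_isotropic_z i2 b0).
  by rewrite -[RHS]N0; ring.
have a0 : a = 0.
  by apply/eqP; rewrite -sqrf_eq0 -[X in _ == X]N0 b0 c0 expr0n !addr0.
exists 1, 0, 0; rewrite a0 b0 c0; split; ring.
Qed.

(** If [x - e_1] and [x + e_1] both have norm zero, then subtracting the norms
    gives [4 a = 0]. *)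
Lemma unit_translate_anisotropic_x (a b c : F) : a != 0 -> exists u v w,
  u ^+ 2 + v ^+ 2 + w ^+ 2 = 1 /\
  (a - u) ^+ 2 + (b - v) ^+ 2 + (c - w) ^+ 2 != 0.
Proof.
move=> a0.
have [m0|] := eqVneq ((a - 1) ^+ 2 + b ^+ 2 + c ^+ 2) 0; last first.
  by move=> m0; exists 1, 0, 0; rewrite !subr0; split=> //; ring.
exists (- 1), 0, 0; split; first by ring.
have : 2 * (2 * a) != 0 by rewrite !mulf_neq0 ?two_neq0.
apply: contra_neq => p0.
by rewrite -[RHS]p0 -[RHS]subr0 -[X in _ = _ - X]m0; ring.
Qed.

(** For [x <> 0] some [x - e_i] or [x + e_i] has nonzero norm, and for [x = 0]
    the translate [- e_1] has norm [1]. *)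
Lemma unit_translate_anisotropic (a b c : F) : exists u v w,
  u ^+ 2 + v ^+ 2 + w ^+ 2 = 1 /\
  (a - u) ^+ 2 + (b - v) ^+ 2 + (c - w) ^+ 2 != 0.
Proof.
have [a0|/unit_translate_anisotropic_x //] := eqVneq a 0.
have [b0|/(@unit_translate_anisotropic_x b c a)] := eqVneq b 0; last first.
  move=> [v [w [u [n1 n2]]]]; exists u, v, w.
  split; first by rewrite -[RHS]n1; ring.
  by apply: contra_neq n2 => <-; ring.
have [c0|/(@unit_translate_anisotropic_x c a b)] := eqVneq c 0; last first.
  move=> [w [u [v [n1 n2]]]]; exists u, v, w.
  split; first by rewrite -[RHS]n1; ring.
  by apply: contra_neq n2 => <-; ring.
exists 1, 0, 0; split; first by ring.
by rewrite a0 b0 c0 !subr0 sub0r sqrrN expr1n expr0n !addr0 oner_eq0.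
Qed.

End OddFiniteField.

(** * From coordinates to row vectors *)

Lemma sum_of_unit_vectors1 (F : finFieldType) d (x : 'rV[F]_d) :
  unit_vector x -> sum_of_unit_vectors 1 x.
Proof. by move=> x1; exists (fun=> x); rewrite big_ord1. Qed.

Lemma sum_of_unit_vectorsS (F : finFieldType) d m (u x : 'rV[F]_d) :
  unit_vector u -> sum_of_unit_vectors m (x - u) ->
  sum_of_unit_vectors m.+1 x.
Proof.
move=> u1 [v [v1 xuE]].
exists (fun j => oapp v u (unlift ord0 j)); split=> [j|].
  by case: unliftP => [k|] _ /=; [apply: v1 | apply: u1].
rewrite big_ord_recl unlift_none /= (eq_bigr v) => [|j _].
  by rewrite -xuE addrC subrK.
by rewrite liftK.
Qed.

Definition row3 (F : finFieldType) (a b c : F) : 'rV[F]_3 :=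
  \row_i [:: a; b; c]`_i.

Lemma row3_ex (F : finFieldType) (x : 'rV[F]_3) :
  exists a b c, x = row3 a b c.
Proof.
exists (x 0 (inord 0)), (x 0 (inord 1)), (x 0 (inord 2)).
apply/rowP => i; rewrite mxE -[in LHS](inord_val i).
by case: i => [[|[|[|]]]].
Qed.

Lemma row3B (F : finFieldType) (a b c u v w : F) :
  row3 a b c - row3 u v w = row3 (a - u) (b - v) (c - w).
Proof. by apply/rowP => i; rewrite !mxE; case: i => [[|[|[|]]]]. Qed.

Lemma sqnorm_row3 (F : finFieldType) (a b c : F) :
  sqnorm (row3 a b c) = a ^+ 2 + b ^+ 2 + c ^+ 2.
Proof. by rewrite /sqnorm !big_ord_recr big_ord0 !mxE /= add0r. Qed.

Lemma two_units_row3 (F : finFieldType) (a b c : F) :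
  two_units a b c -> sum_of_unit_vectors 2 (row3 a b c).
Proof.
move=> [u [v [w [n1 n2]]]].
apply: (@sum_of_unit_vectorsS _ _ _ (row3 u v w)).
  by rewrite /unit_vector sqnorm_row3.
by apply: sum_of_unit_vectors1; rewrite /unit_vector row3B sqnorm_row3.
Qed.

Theorem proposition1p7 (p n q : nat) (p_prime : prime p) (p_odd : odd p)
    (n_gt0 : (0 < n)%N) (q_def : q = (p ^ n)%N)
    (F : finFieldType) (cardF : #|F| = q) :
  ((q = 3 %[mod 4])%N ->
     forall x : 'rV[F]_3, sum_of_unit_vectors 3 x) /\
  ((q = 1 %[mod 4])%N ->
     forall x : 'rV[F]_3, sum_of_unit_vectors 2 x).
Proof.
have oddF : odd #|F| by rewrite cardF q_def oddX p_odd orbT.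
split=> q4 x; have [a [b [c ->]]] := row3_ex x.
  have [u [v [w [n1 n2]]]] := unit_translate_anisotropic oddF a b c.
  apply: (@sum_of_unit_vectorsS _ _ _ (row3 u v w)).
    by rewrite /unit_vector sqnorm_row3.
  by rewrite row3B; apply/two_units_row3/two_units_anisotropic.
apply: two_units_row3.
have [N0|] := eqVneq (a ^+ 2 + b ^+ 2 + c ^+ 2) 0; last first.
  exact: two_units_anisotropic.
rewrite -cardF in q4; have [i i2] := sqrt_m1 q4.
exact: two_units_isotropic i2 N0.
Qed.
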